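(* Consider the gadget instance with $n$ gadgets described in the context, run by any ack-only distributed algorithm in which all senders start at the same time in the same state and execute the identical randomized algorithm. Let $I(n)$ be the smallest time at which none of the gadgets is active. Then ${\mathbb{E}}(I(n))=\Omega(\log n)$.
   Context: SINR model: a link $\ell_v$ has sender $s_v$ and receiver $r_v$; with uniform power, a transmitting link $\ell_v$ succeeds iff $\frac{1/\ell_v^\alpha}{\sum_{\ell_w\in S\setminus\{\ell_v\}}1/d(s_w,r_v)^\alpha+N}\ge\beta$, where $S$ is the set of links transmitting in that slot. Instance: $\alpha>1$, $\beta=2$, $N=0$, uniform power; for $i=1,\dots,n$, gadget $g_i$ consists of two identical links of length $1$ on the real line, both senders at point $2ni$ and both receivers at point $2ni+1$ (this set of $2n$ links can be scheduled in 2 slots). Gadget $g_i$ is active at time $t$ if neither of its links has succeeded by time $t-1$. An ack-only algorithm is one where the only external information a sender receives is an acknowledgement of its own successful transmission. *)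

(* Defs.v *)
From HB Require Import structures.
From mathcomp Require Export all_boot all_order all_algebra.
From mathcomp Require Export all_classical all_reals all_analysis.

Set Implicit Arguments.
Unset Strict Implicit.
Unset Printing Implicit Defensive.

Import Order.TTheory GRing.Theory Num.Theory.

Local Open Scope classical_set_scope.
Local Open Scope ring_scope.

Record link (R : realType) := Link { sender : R; receiver : R }.

Section SINR.
Variables (R : realType) (alpha beta N : R) (V : finType) (L : V -> link R).

Definition dist (w v : V) : R := `|sender (L w) - receiver (L v)|.

(* All quotients are taken in the extended reals, where 1 / 0 = +oo: with N = 0
   a link that transmits alone has SINR +oo, and hence succeeds. *)
Definition received_power (w v : V) : \bar R := ((dist w v `^ alpha)%:E^-1)%E.

Definition sinr (S : {set V}) (v : V) : \bar R :=
  (received_power v v /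
    (\sum_(w in S | w != v) received_power w v + N%:E))%E.

Definition success (S : {set V}) (v : V) : bool :=
  (v \in S) && (beta%:E <= sinr S v)%E.

End SINR.

(* A sender holds an internal state and a private random tape of type X.  In
   each slot it decides from these whether to transmit, then moves to a new
   state; the boolean argument of [next], which says whether its own
   transmission of this slot succeeded, is the only external information it
   ever receives. *)
Record ack_only_algorithm (d : measure_display) (X : measurableType d) := AckOnly {
  state_display : measure_display;
  state : measurableType state_display;
  init : state;
  transmit : state * X -> bool;
  next : bool -> state * X -> state;
  measurable_transmit : measurable_fun setT transmit;
  measurable_next : forall ack : bool, measurable_fun setT (next ack) }.

Section Execution.
Variables (R : realType) (alpha beta N : R) (V : finType) (L : V -> link R).
Variables (d : measure_display) (X : measurableType d).
Variables (A : ack_only_algorithm X) (tape : V -> X).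

Definition transmitters (st : V -> state A) : {set V} :=
  finset (fun v => transmit (st v, tape v)).

(* The states at the end of slot t; the slots are 1, 2, 3, and so on. *)
Fixpoint config (t : nat) : V -> state A :=
  if t is t'.+1 then
    fun v => next (success alpha beta N L (transmitters (config t')) v)
                  (config t' v, tape v)
  else fun=> init A.

Definition succeeds_at (t : nat) (v : V) : bool :=
  success alpha beta N L (transmitters (config t.-1)) v.

End Execution.

Section Gadgets.
Variables (R : realType) (alpha : R) (n : nat).

(* The index i : 'I_n stands for gadget i + 1; the boolean selects one of the
   two links of the gadget. *)
Definition gadget_links (v : 'I_n * bool) : link R :=
  Link ((2 * n * v.1.+1)%:R) ((2 * n * v.1.+1)%:R + 1).

Variables (d : measure_display) (X : measurableType d).
Variables (A : ack_only_algorithm X) (tape : 'I_n * bool -> X).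

Definition active (i : 'I_n) (t : nat) : Prop :=
  forall (s : nat) (b : bool), (1 <= s <= t.-1)%N ->
    ~~ succeeds_at alpha 2 0 gadget_links A tape s (i, b).

(* I(n), with value +oo (the infimum of the empty set) if some gadget stays
   active forever. *)
Definition inactivity_time : \bar R :=
  ereal_inf [set (t%:R)%:E | t in
    [set t : nat | (1 <= t)%N /\ forall i : 'I_n, ~ active i t]].

End Gadgets.

Section IID.
Variables (R : realType) (d d' : measure_display).
Variables (T : measurableType d) (X : measurableType d').
Variables (P : probability T R) (V : finType) (xi : V -> {RV P >-> X}).

Definition mutually_independent : Prop :=
  forall (J : {set V}) (B : V -> set X), (forall v, measurable (B v)) ->
    P (\bigcap_(v in [set` J]) (xi v @^-1` B v))
    = (\prod_(v in J) P (xi v @^-1` B v))%E.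

Definition identically_distributed : Prop :=
  forall (v w : V) (B : set X), measurable B ->
    P (xi v @^-1` B) = P (xi w @^-1` B).

End IID.

(* Main.v *)
(** Until its first acknowledgement a sender behaves as a function of its own
    tape alone.  So as long as the two senders of a gadget make the same
    transmit/idle decisions, every slot is either silent or a collision in that
    gadget, whatever the other gadgets do, and the gadget stays active.  The
    decisions in slots 1, ..., k form one of 2^k words, so two independent
    identically distributed words coincide with probability at least 2^-k by
    the Cauchy-Schwarz inequality.  The gadgets being independent, all of them
    see two different words with probability at most (1 - 2^-k)^n, which is at
    most exp(-1) < 1/2 when 2^k <= n.  With k the integer part of log2 n, this
    gives E(I(n)) >= (k + 1) / 2 >= ln n / 2. *)

From mathcomp Require Import ring lra.
Require Import Defs.

Set Implicit Arguments.
Unset Strict Implicit.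
Unset Printing Implicit Defensive.

Import Order.TTheory GRing.Theory Num.Theory.
Local Open Scope classical_set_scope.
Local Open Scope ring_scope.

Lemma sqr_sum_le_card (R : realDomainType) (W : finType) (p : W -> R) :
  (\sum_u p u) ^+ 2 <= #|W|%:R * \sum_u p u ^+ 2.
Proof.
set S := \sum_u p u; set Q := \sum_u p u ^+ 2; set m : R := #|W|%:R.
have sum_sqr_sub u :
    \sum_v (p u - p v) ^+ 2 = m * p u ^+ 2 + (- 2 * S * p u + Q).
  rewrite (eq_bigr (fun v => p u ^+ 2 + (- 2 * p u * p v + p v ^+ 2))).
    rewrite !big_split /= sumr_const -mulr_sumr -[p u ^+ 2 *+ _]mulr_natl.
    by rewrite -/m -/S -/Q; ring.
  by move=> v _; ring.
have : 0 <= \sum_u \sum_v (p u - p v) ^+ 2.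
  by apply: sumr_ge0 => u _; apply: sumr_ge0 => v _; exact: sqr_ge0.
under eq_bigr do rewrite sum_sqr_sub.
rewrite !big_split /= sumr_const -!mulr_sumr -[Q *+ _]mulr_natl -/m -/S -/Q.
have -> : m * Q + (- 2 * S * S + m * Q) = 2 * (m * Q - S ^+ 2) by ring.
by rewrite pmulr_rge0 ?ltr0n// subr_ge0.
Qed.

Lemma sum_offdiag_le (R : realFieldType) (W : finType) (p : W -> R) :
  \sum_u p u = 1 ->
  \sum_(q : W * W | q.1 != q.2) p q.1 * p q.2 <= 1 - #|W|%:R^-1.
Proof.
move=> p1.
have diag : \sum_(q : W * W | q.1 == q.2) p q.1 * p q.2 = \sum_u p u ^+ 2.
  rewrite -(pair_big_dep predT (fun a b => a == b) (fun a b => p a * p b)) /=.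
  by apply: eq_bigr => u _; rewrite (big_pred1 u)// => v; rewrite eq_sym.
have total : \sum_(q : W * W) p q.1 * p q.2 = 1.
  rewrite -(pair_bigA _ (fun a b => p a * p b)) /=.
  by under eq_bigr do rewrite -mulr_sumr p1 mulr1.
have collision_ge : #|W|%:R^-1 <= \sum_u p u ^+ 2.
  have := sqr_sum_le_card p; rewrite p1 expr1n.
  have [->|W0] := posnP #|W|; first by rewrite mul0r ler10.
  by rewrite -ler_pdivrMl ?ltr0n// mulr1.
by move: total; rewrite (bigID (fun q : W * W => q.1 == q.2)) /= diag; lra.
Qed.

Lemma sum_prod_ffun_pairs (R : comNzSemiRingType) (I W : finType) (Q : rel W)
    (F : I * bool -> W -> R) :
  \sum_(g : {ffun I * bool -> W} | [forall i, Q (g (i, true)) (g (i, false))])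
     \prod_v F v (g v) =
  \prod_i \sum_(q : W * W | Q q.1 q.2) F (i, true) q.1 * F (i, false) q.2.
Proof.
pose uncurry (f : {ffun I -> W * W}) : {ffun I * bool -> W} :=
  [ffun v => if v.2 then (f v.1).1 else (f v.1).2].
pose curry (g : {ffun I * bool -> W}) : {ffun I -> W * W} :=
  [ffun i => (g (i, true), g (i, false))].
rewrite (bigA_distr_big _ (fun i q => F (i, true) q.1 * F (i, false) q.2)).
rewrite (reindex uncurry) /=; last first.
  exists curry => [f _|g _]; apply/ffunP.
    by move=> i; rewrite !ffunE -surjective_pairing.
  by case=> i []; rewrite !ffunE.
apply: eq_big => [f|f _].
  by apply/forallP/ffun_onP => Qf i; have := Qf i; rewrite !ffunE.
rewrite (eq_bigr (fun v => F (v.1, v.2) (uncurry f (v.1, v.2)))); last by case.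
rewrite -(pair_bigA _ (fun i b => F (i, b) (uncurry f (i, b)))) /=.
by apply: eq_bigr => i _; rewrite big_bool !ffunE.
Qed.

(* The integral of a nonnegative function, measurable or not, is the supremum of
   the integrals of the simple functions below it. *)
Lemma ge0_le_integral_nonmeasurable (d : measure_display) (T : measurableType d)
    (R : realType) (mu : {measure set T -> \bar R}) (f g : T -> \bar R) :
  (forall x, 0 <= f x)%E -> (forall x, f x <= g x)%E ->
  (\int[mu]_x f x <= \int[mu]_x g x)%E.
Proof.
move=> f0 fg; have g0 x : (0 <= g x)%E by exact: le_trans (fg x).
rewrite !ge0_integralTE//; apply: ereal_sup_le => _ [h hf <-].
by exists h => // x; exact: le_trans (fg x).
Qed.

Lemma markov_nonmeasurable (d : measure_display) (T : measurableType d)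
    (R : realType) (mu : {measure set T -> \bar R}) (f : T -> \bar R)
    (D : set T) (a : \bar R) :
  measurable D -> (0 <= a)%E -> (forall x, 0 <= f x)%E ->
  (forall x, D x -> a <= f x)%E -> (a * mu D <= \int[mu]_x f x)%E.
Proof.
move=> mD a0 f0 af; rewrite -integral_cst// integral_mkcond.
apply: ge0_le_integral_nonmeasurable => x; first exact: erestrict_ge0.
by rewrite patchE; case: ifPn => // /set_mem; exact: af.
Qed.

Section FiniteValued.
Variables (d : measure_display) (T : measurableType d).
Variables (W : finType) (f : T -> W).
Hypothesis mf : forall u, measurable (f @^-1` [set u]).

Let preimage_bigcup (Q : pred W) :
  f @^-1` [set` Q] = \bigcup_(u in [set` Q]) f @^-1` [set u].
Proof. by apply/seteqP; split=> [x Qx|x [u Qu /= ->]]//; exists (f x). Qed.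

Lemma measurable_preimage_finType (Q : pred W) : measurable (f @^-1` [set` Q]).
Proof. by rewrite preimage_bigcup; exact: fin_bigcup_measurable. Qed.

Lemma measure_preimage_finType (R : realType) (mu : {measure set T -> \bar R})
    (Q : pred W) :
  mu (f @^-1` [set` Q]) = (\sum_(u | Q u) mu (f @^-1` [set u]))%E.
Proof.
rewrite preimage_bigcup measure_fin_bigcup//; last exact: trivIset_preimage1.
by rewrite -(bigfs _ (index_enum_uniq W))// => u _; rewrite mem_index_enum.
Qed.

End FiniteValued.

Section Codes.
Variables (R : realType) (d d' : measure_display) (T : measurableType d).
Variables (X : measurableType d') (P : probability T R) (W : finType).
Variable code : X -> W.
Hypothesis mcode : forall u, measurable (code @^-1` [set u]).

Definition code_law (Y : {RV P >-> X}) (u : W) : R :=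
  fine (P (Y @^-1` (code @^-1` [set u]))).

Let measurable_code_RV (Y : {RV P >-> X}) u :
  measurable (Y @^-1` (code @^-1` [set u])).
Proof. exact/measurable_funPTI/mcode. Qed.

Lemma code_lawE (Y : {RV P >-> X}) u :
  P (Y @^-1` (code @^-1` [set u])) = (code_law Y u)%:E.
Proof. by rewrite fineK// fin_num_measure//; exact: measurable_code_RV. Qed.

Lemma code_law_ge0 (Y : {RV P >-> X}) u : 0 <= code_law Y u.
Proof. exact: fine_ge0. Qed.

Lemma sum_code_law (Y : {RV P >-> X}) : \sum_u code_law Y u = 1.
Proof.
apply: EFin_inj; rewrite -sumEFin -[RHS](probability_setT P).
rewrite (_ : setT = (code \o Y) @^-1` [set` predT]); last exact/esym/seteqP.
rewrite measure_preimage_finType; last exact: measurable_code_RV.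
by apply: eq_bigr => u _; rewrite -code_lawE.
Qed.

Section CodeVector.
Variables (V : finType) (xi : V -> {RV P >-> X}).

Definition code_vector (w : T) : {ffun V -> W} := [ffun v => code (xi v w)].

Let code_vectorE g : code_vector @^-1` [set g] =
  \bigcap_(v in [set` [set: V]%SET]) (xi v @^-1` (code @^-1` [set g v])).
Proof.
apply/seteqP; split=> [w /= <- v _|w /= codes_g]; first by rewrite /= ffunE.
by apply/ffunP => v; rewrite ffunE; apply: codes_g; rewrite /= inE.
Qed.

Lemma measurable_code_vector g : measurable (code_vector @^-1` [set g]).
Proof. by rewrite code_vectorE; exact: fin_bigcap_measurable. Qed.

Lemma probability_code_vector (Q : pred {ffun V -> W}) :
  mutually_independent xi ->
  P (code_vector @^-1` [set` Q]) =
  (\sum_(g | Q g) \prod_v code_law (xi v) (g v))%:E.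
Proof.
move=> indep; rewrite measure_preimage_finType; last first.
  exact: measurable_code_vector.
rewrite -sumEFin; apply: eq_bigr => g _.
rewrite code_vectorE; have /= -> := indep [set: V]%SET _ (fun v => mcode (g v)).
under eq_bigr do rewrite code_lawE.
by rewrite prodEFin; congr EFin; apply: eq_bigl => v; rewrite inE.
Qed.

End CodeVector.

Section Twins.
Variables (I : finType) (xi : I * bool -> {RV P >-> X}).

Definition some_twins_agree : set T :=
  [set w | exists i, code (xi (i, true) w) = code (xi (i, false) w)].

Let no_twins_agreeE : ~` some_twins_agree = code_vector xi @^-1`
  [set` [pred g | [forall i, g (i, true) != g (i, false)]]].
Proof.
apply/seteqP; split=> w /= => [none|/forallP differ [i]].
  apply/forallP => i; rewrite !ffunE; apply/eqP => agree.
  by apply: none; exists i.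
by have := differ i; rewrite !ffunE => /eqP.
Qed.

Lemma measurable_some_twins_agree : measurable some_twins_agree.
Proof.
rewrite -[some_twins_agree]setCK no_twins_agreeE; apply: measurableC.
exact/measurable_preimage_finType/measurable_code_vector.
Qed.

Lemma probability_some_twins_agree_ge :
    mutually_independent xi ->
    (forall i, code_law (xi (i, false)) =1 code_law (xi (i, true))) ->
  ((1 - (1 - #|W|%:R^-1) ^+ #|I|)%:E <= P some_twins_agree)%E.
Proof.
move=> indep same_law; rewrite -[some_twins_agree]setCK no_twins_agreeE.
rewrite probability_setC; last first.
  exact/measurable_preimage_finType/measurable_code_vector.
rewrite probability_code_vector//=.
have /= -> :=
  sum_prod_ffun_pairs (fun a b => a != b) (fun v => code_law (xi v)).
rewrite -EFinB lee_fin lerB// -prodr_const; apply: ler_prod => i _.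
apply/andP; split.
  by apply: sumr_ge0 => q _; rewrite mulr_ge0// code_law_ge0.
under eq_bigr do rewrite same_law.
exact/sum_offdiag_le/sum_code_law.
Qed.

End Twins.
End Codes.

Section NeverAcknowledged.
Variables (d : measure_display) (X : measurableType d).
Variable A : ack_only_algorithm X.

Fixpoint silent_state (t : nat) (x : X) : state A :=
  if t is t'.+1 then next false (silent_state t' x, x) else init A.

(* The decision taken in slot [t.+1]. *)
Definition decision (t : nat) (x : X) : bool := transmit (silent_state t x, x).

Definition decisions (k : nat) (x : X) : {ffun 'I_k -> bool} :=
  [ffun t : 'I_k => decision t x].

Lemma measurable_silent_state t : measurable_fun setT (silent_state t).
Proof.
elim: t => [|t IH] /=; first exact: measurable_cst.
apply: (measurableT_comp (g := fun x => (silent_state t x, x))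
  (@measurable_next _ _ A false)).
exact: measurable_fun_pair.
Qed.

Lemma measurable_decision t : measurable_fun setT (decision t).
Proof.
apply: (measurableT_comp (g := fun x => (silent_state t x, x))
  (@measurable_transmit _ _ A)).
by apply: measurable_fun_pair; first exact: measurable_silent_state.
Qed.

Lemma measurable_decisions k u : measurable (decisions k @^-1` [set u]).
Proof.
have -> : decisions k @^-1` [set u] =
    \bigcap_(t in [set: 'I_k]) (decision t @^-1` [set u t]).
  apply/seteqP; split=> [x /= <- t _ |x decisions_u]; first by rewrite /= ffunE.
  by apply/ffunP => t; rewrite ffunE; exact: decisions_u.
apply: fin_bigcap_measurable => // t _.
by rewrite -[X in measurable X]setTI; exact: measurable_decision.
Qed.

Lemma config_unacknowledged (R : realType) (alpha beta N : R) (V : finType)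
    (L : V -> link R) (tape : V -> X) (t : nat) (v : V) :
  (forall s, (1 <= s <= t)%N -> ~~ succeeds_at alpha beta N L A tape s v) ->
  config alpha beta N L A tape t v = silent_state t (tape v).
Proof.
elim: t => [//|t IH] unack /=; rewrite IH.
  by have := unack t.+1 (leqnn _); rewrite /succeeds_at /= => /negbTE->.
by move=> s /andP[s1 st]; apply: unack; rewrite s1 ltnW.
Qed.

End NeverAcknowledged.

Lemma ge0_dive_le1 (R : realFieldType) (x y : \bar R) :
  (0 <= x)%E -> (x <= y)%E -> (x / y <= 1)%E.
Proof.
move: x y => [x| |] [y| |]//; rewrite ?invey ?mule0 ?lee_fin// => x0 xy.
have [y0|y0] := leP y 0.
  have -> : x = 0 by apply/eqP; rewrite eq_le x0 (le_trans xy).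
  by rewrite mul0e lee_fin.
by rewrite inver gt_eqF// lee_pdivrMr// mul1e lee_fin.
Qed.

Section Collision.
Variables (R : realType) (alpha beta N : R) (V : finType) (L : V -> link R).
Hypotheses (beta_gt1 : 1 < beta) (N_ge0 : 0 <= N).

Lemma received_power_ge0 w v : (0 <= received_power alpha L w v)%E.
Proof. by rewrite inve_ge0 lee_fin powR_ge0. Qed.

Lemma colocated_sender_collision (S : {set V}) (v w : V) :
  w \in S -> w != v -> sender (L w) = sender (L v) ->
  ~~ success alpha beta N L S v.
Proof.
move=> wS wv same_sender; rewrite negb_and -ltNge; apply/orP; right.
apply: (@le_lt_trans _ _ 1%E); last by rewrite lte_fin.
apply: ge0_dive_le1; first exact: received_power_ge0.
rewrite (bigD1 w) /=; last by rewrite wS.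
have -> : received_power alpha L w v = received_power alpha L v v.
  by rewrite /received_power /dist same_sender.
rewrite -addeA leeDl// adde_ge0 ?lee_fin//.
by apply: sume_ge0 => u _; exact: received_power_ge0.
Qed.

End Collision.

Section GadgetExecution.
Variables (R : realType) (alpha : R) (n : nat).
Local Notation L := (@gadget_links R n).

Lemma gadget_collision (S : {set 'I_n * bool}) (i : 'I_n) (b : bool) :
  ((i, true) \in S) = ((i, false) \in S) -> ~~ success alpha 2 0 L S (i, b).
Proof.
move=> both; have [twinS|twinNS] := boolP ((i, ~~ b) \in S).
  apply: colocated_sender_collision twinS _ _; rewrite ?ltr1n//.
  by rewrite xpair_eqE eqxx; case: b.
rewrite negb_and; case: b twinNS => /= /negbTE.
  by rewrite both => ->.
by rewrite -both => ->.
Qed.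

Variables (d : measure_display) (X : measurableType d).
Variables (A : ack_only_algorithm X) (tape : 'I_n * bool -> X).

Lemma inactivity_time_ge0 : (0 <= inactivity_time alpha A tape)%E.
Proof. by apply: le_ereal_inf_tmp => _ [t _ <-]; rewrite lee_fin. Qed.

Variables (k : nat) (i : 'I_n).
Hypothesis same_decisions :
  decisions A k (tape (i, true)) = decisions A k (tape (i, false)).

Lemma active_same_decisions t : (t <= k)%N -> active alpha A tape i t.+1.
Proof.
elim: t => [_ [|s] b //|t IH tk].
have active_t := IH (ltnW tk).
move=> s b /andP[s1]; rewrite leq_eqVlt => /predU1P[->|st]; last first.
  by apply: (active_t s b); rewrite s1.
apply: gadget_collision; rewrite !inE !config_unacknowledged.
- by have /ffunP/(_ (Ordinal tk)) := same_decisions; rewrite !ffunE.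
- exact: (active_t ^~ false).
- exact: (active_t ^~ true).
Qed.

Lemma inactivity_time_ge_same_decisions :
  ((k.+1%:R)%:E <= inactivity_time alpha A tape)%E.
Proof.
apply: le_ereal_inf_tmp => _ [[|t] [// _ inactive] <-]; rewrite lee_fin ler_nat.
rewrite leqNgt; apply/negP => tk; apply: (inactive i).
exact/active_same_decisions/ltnW.
Qed.

End GadgetExecution.

Lemma expected_inactivity_time_ge (R : realType) (alpha : R) (n k : nat)
    (d : measure_display) (X : measurableType d) (A : ack_only_algorithm X)
    (d' : measure_display) (T : measurableType d') (P : probability T R)
    (xi : 'I_n * bool -> {RV P >-> X}) :
  mutually_independent xi -> identically_distributed xi ->
  ((k.+1%:R * (1 - (1 - (2 ^ k)%:R^-1) ^+ n))%:E <=
    \int[P]_w inactivity_time alpha A (fun v => xi v w))%E.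
Proof.
move=> indep ident; have mdec := @measurable_decisions _ _ A k.
have same_law i :
    code_law (decisions A k) (xi (i, false)) =1
    code_law (decisions A k) (xi (i, true)).
  by move=> u; congr fine; exact/ident/mdec.
rewrite EFinM.
apply: (@le_trans _ _ (k.+1%:R%:E * P (some_twins_agree (decisions A k) xi))%E).
  apply: lee_wpmul2l; first by rewrite lee_fin.
  have := probability_some_twins_agree_ge mdec indep same_law.
  by rewrite card_ffun card_bool !card_ord.
apply: markov_nonmeasurable => //; first exact: measurable_some_twins_agree.
  by move=> w; exact: inactivity_time_ge0.
by move=> w [i]; exact: inactivity_time_ge_same_decisions.
Qed.

Lemma onem_invX_le_half (R : realType) (m n : nat) : (0 < m)%N -> (m <= n)%N ->
  (1 - m%:R^-1) ^+ n <= 2^-1 :> R.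
Proof.
move=> m0 mn; apply: (@le_trans _ _ (expR (- m%:R^-1) ^+ n)).
  rewrite lerXn2r ?nnegrE ?expR_ge0 ?expR_ge1Dx//.
  by rewrite subr_ge0 invf_le1 ?ler1n ?ltr0n.
rewrite -expRM_natl mulrN expRN lef_pV2 ?posrE ?expR_gt0//.
apply: le_trans (expR_ge1Dx _).
by rewrite -[X in X <= _]/(1 + 1) lerD2l ler_pdivlMr ?ltr0n// mul1r ler_nat.
Qed.

Lemma ln_le_trunc_log (R : realType) (p n : nat) : (1 < p)%N -> (0 < n)%N ->
  ln n%:R <= (trunc_log p n).+1%:R * ln p%:R :> R.
Proof.
move=> p1 n0; have p0 := ltnW p1; rewrite mulr_natl -lnXn ?ltr0n// -natrX.
by rewrite ler_ln ?posrE ?ltr0n ?expn_gt0 ?p0// ler_nat ltnW// trunc_log_ltn.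
Qed.

Theorem theorem4 (R : realType) (alpha : R) (alpha_gt1 : 1 < alpha) :
  exists2 c : R, 0 < c & exists n0 : nat, forall n : nat, (n0 <= n)%N ->
    forall (d : measure_display) (X : measurableType d)
      (A : ack_only_algorithm X)
      (d' : measure_display) (T : measurableType d') (P : probability T R)
      (xi : 'I_n * bool -> {RV P >-> X}),
    mutually_independent xi -> identically_distributed xi ->
    ((c * ln n%:R)%:E <=
      \int[P]_w inactivity_time alpha A (fun v => xi v w))%E.
Proof.
exists 2^-1; first by rewrite invr_gt0.
exists 1 => n n0 d X A d' T P xi indep ident.
pose k := trunc_log 2 n.
apply: le_trans (expected_inactivity_time_ge alpha k A indep ident).
have agree_ge_half : 2^-1 <= 1 - (1 - (2 ^ k)%:R^-1) ^+ n :> R.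
  have pow_le_n := trunc_logP (ltnSn 1) n0.
  by have := @onem_invX_le_half R _ n (expn_gt0 2 k) pow_le_n; lra.
have ln_n_le : ln n%:R <= k.+1%:R :> R.
  apply: le_trans (ln_le_trunc_log R (ltnSn 1) n0) _.
  rewrite ger_pMr ?ltr0n//.
  by apply: (@le_ln1Dx R 1); rewrite (lt_trans _ ltr01)// ltrN10.
by rewrite lee_fin mulrC ler_pM// ?ln_ge0 ?ler1n.
Qed.
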